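(* Let $q$ be an odd prime power, $d\ge2$ an integer, and $\epsilon>0$. Given $A,B\subset\mathbb{F}_q^d$ with $|A|\le|B|$ and $|B|^{1+\epsilon}<q^d/2$, there exists $E\subset O(d)$ with $$|E|\ll\frac{|O(d-1)|\,q^d|B|^{\epsilon}}{|A|}$$ such that for all $g\in O(d)\setminus E$ we have $$|A-gB|\gg|B|^{1+\epsilon}.$$
   Context: $\mathbb{F}_q$ is the finite field with $q$ elements. $O(n)$ is the group of $n\times n$ orthogonal matrices over $\mathbb{F}_q$ (those preserving $\|x\|=x_1^2+\cdots+x_n^2$). $A-gB=\{a-gb:a\in A,\ b\in B\}$. $X\ll Y$ (equivalently $Y\gg X$) means $X\le CY$ for an absolute constant $C>0$; implicit constants may depend on $d$ only. *)

(* Defs.v *)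
From mathcomp Require Import all_boot all_order all_algebra.
From mathcomp Require Import reals exp.

Set Implicit Arguments.
Unset Strict Implicit.
Unset Printing Implicit Defensive.

Import Order.TTheory GRing.Theory Num.Theory.

Local Open Scope ring_scope.

(* ||x|| is the quadratic form itself: no square root is taken. *)
Definition normq (F : finFieldType) (n : nat) (x : 'cV[F]_n) : F :=
  \sum_(i < n) x i 0 ^+ 2.

(* Invertibility is not imposed: when #|F| is odd, preserving the form forces
   g^T *m g = 1%:M by polarization. *)
Definition orthmx (F : finFieldType) (n : nat) : {set 'M[F]_n} :=
  [set g : 'M[F]_n | [forall x : 'cV[F]_n, normq (g *m x) == normq x]].

Definition rotdiff (F : finFieldType) (n : nat) (A : {set 'cV[F]_n})
    (g : 'M[F]_n) (B : {set 'cV[F]_n}) : {set 'cV[F]_n} :=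
  [set a - g *m b | a in A, b in B].

(* Main.v *)
Require Import Defs.
From mathcomp Require Import all_boot all_order all_algebra.
From mathcomp Require Import reals exp.
From mathcomp Require Import zify ring lra.

(** Write q for the order of F, P for A x B and X for the threshold
    |B|^(1 + eps), and let e(g) be the number of pairs of points of P with the
    same value of a - g b.  By Cauchy-Schwarz |P|^2 <= |A - gB| e(g), so a
    rotation with |A - gB| < X has e(g) > |P|^2 / X, and since X < q^d / 2
    this exceeds the value |P|^2 / q^d of perfect equidistribution by at least
    |P|^2 / (2X).  The set E of all such rotations is small because the total
    excess is under control ([sum_collisions_rotsub]):
      sum over g in O(d) of (e(g) - |P|^2 / q^d) <= S q^d |P|,
    where S bounds the number of g in O(d) with g x = y, for x nonzero.
    Comparing the two, |E| |P| <= 2 S q^d X, which is the claimed bound as soon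
    as S is at most a constant times |O(d-1)|.

    The second moment bound is usually obtained by Fourier analysis on F^d x
    F^d.  Characters are avoided here by cutting with hyperplanes instead: for
    a map f from P to F^n and a vector m, the function p |-> m . f(p) takes at
    most q values, so its number of collisions is at least |P|^2 / q, and
    summing q times this number, less |P|^2, over all nonzero m recovers the
    collisions of f itself ([sum_excess]).  This plays the part of Plancherel's
    identity, with nonnegative terms.  It is used twice: for (a, b) |-> a - g b
    the vector m contributes the term of the identity for (a, b) |-> (a, b)
    indexed by (m, - g^T m), and a given (u, v) arises from at most S pairs
    (g, m), so that summing over g costs a factor S.  The remaining sum is
    controlled by the injectivity of (a, b) |-> (a, b).

    The estimate for S ([card_orth_map_leq]) rests on two facts.  First,
    |O(d)| <= 2 q^(d-1) |O(d-1)|, because the first column of g lies on a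
    sphere and the matrices with a given first column form a coset of O(d-1)
    or the empty set.  Secondly, reflections move y to many places: about q^d
    vectors w define a reflection moving y, and a given displacement comes
    from at most q of them.  All the sets of g mapping x to one of these places
    are at least as large as the one for y, so S q^d is at most a constant
    times q |O(d)|. *)

Set Implicit Arguments.
Unset Strict Implicit.
Unset Printing Implicit Defensive.

Import Order.TTheory GRing.Theory Num.Theory.

Local Open Scope ring_scope.

(** * Collisions of a map on a finite set *)

Lemma sqr_sum_leq (I : finType) (S : {pred I}) (r : I -> nat) :
  ((\sum_(i in S) r i) ^ 2 <= #|S| * \sum_(i in S) r i ^ 2)%N.
Proof.
rewrite -(leq_pmul2l (isT : 0 < 2)%N).
have -> : (2 * (\sum_(i in S) r i) ^ 2 =
           \sum_(i in S) \sum_(j in S) 2 * (r i * r j))%N.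
  rewrite -mulnn big_distrlr big_distrr /=.
  by apply: eq_bigr => i _; rewrite big_distrr.
have -> : (2 * (#|S| * \sum_(i in S) r i ^ 2) =
           \sum_(i in S) \sum_(j in S) (r i ^ 2 + r j ^ 2))%N.
  under [RHS]eq_bigr => i _ do rewrite big_split /= sum_nat_const.
  by rewrite big_split /= sum_nat_const -big_distrr /=; lia.
by apply: leq_sum => i _; apply: leq_sum => j _; rewrite nat_Cauchy.
Qed.

(** The squared L2 norm of the multiplicity function of [f]; pairs are ordered
    and the diagonal is included. *)
Definition collisions (T : finType) (U : eqType) (P : {set T}) (f : T -> U) :
    nat := (\sum_(p in P) \sum_(p' in P) (f p == f p'))%N.

Lemma card_sqr_leq_collisions (T U : finType) (P : {set T}) (f : T -> U) :
  (#|P| ^ 2 <= #|[set f p | p in P]| * collisions P f)%N.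
Proof.
pose r u := (\sum_(p in P | f p == u) 1)%N.
have -> : collisions P f = (\sum_(u in [set f p | p in P]) r u ^ 2)%N.
  rewrite /collisions (partition_big_imset f) /=.
  apply: eq_bigr => u _; rewrite -mulnn {1}/r big_distrl /=.
  apply: eq_bigr => p /andP[_ /eqP ->].
  rewrite mul1n /r big_mkcondr /=; apply: eq_bigr => p' _.
  by rewrite eq_sym; case: eqP.
have -> : #|P| = (\sum_(u in [set f p | p in P]) r u)%N.
  by rewrite -sum1_card (partition_big_imset f).
exact: sqr_sum_leq.
Qed.

Lemma collisions_inj (T : finType) (U : eqType) (P : {set T}) (f : T -> U) :
  {in P &, injective f} -> collisions P f = #|P|.
Proof.
move=> f_inj; rewrite /collisions -sum1_card; apply: eq_bigr => p Pp.
rewrite (bigD1 p) //= eqxx big1 ?addn0 // => p' /andP[Pp' /negP p'Np].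
by case: eqP => // /(f_inj _ _ Pp Pp') E; case: p'Np; rewrite E.
Qed.

(** * The dot product *)

Definition dotv (F : finFieldType) (n : nat) (u v : 'cV[F]_n) : F :=
  (u^T *m v) 0 0.

Lemma dotvE (F : finFieldType) (n : nat) (u v : 'cV[F]_n) :
  dotv u v = \sum_i u i 0 * v i 0.
Proof. by rewrite /dotv mxE; apply: eq_bigr => i _; rewrite mxE. Qed.

Lemma dotvC (F : finFieldType) (n : nat) (u v : 'cV[F]_n) :
  dotv u v = dotv v u.
Proof. by rewrite !dotvE; apply: eq_bigr => i _; rewrite mulrC. Qed.

Lemma dotvDl (F : finFieldType) (n : nat) (u u' v : 'cV[F]_n) :
  dotv (u + u') v = dotv u v + dotv u' v.
Proof. by rewrite /dotv linearD /= mulmxDl mxE. Qed.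

Lemma dotvZl (F : finFieldType) (n : nat) (a : F) (u v : 'cV[F]_n) :
  dotv (a *: u) v = a * dotv u v.
Proof. by rewrite /dotv linearZ /= -scalemxAl mxE. Qed.

Lemma dotvDr (F : finFieldType) (n : nat) (u v v' : 'cV[F]_n) :
  dotv u (v + v') = dotv u v + dotv u v'.
Proof. by rewrite /dotv mulmxDr mxE. Qed.

Lemma dotvZr (F : finFieldType) (n : nat) (a : F) (u v : 'cV[F]_n) :
  dotv u (a *: v) = a * dotv u v.
Proof. by rewrite /dotv -scalemxAr mxE. Qed.

Lemma dotvBr (F : finFieldType) (n : nat) (u v v' : 'cV[F]_n) :
  dotv u (v - v') = dotv u v - dotv u v'.
Proof. by rewrite dotvDr -scaleN1r dotvZr mulN1r. Qed.

Lemma dot0v (F : finFieldType) (n : nat) (v : 'cV[F]_n) : dotv 0 v = 0.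
Proof. by rewrite /dotv linear0 mul0mx mxE. Qed.

Lemma dotv_mulmx (F : finFieldType) (n : nat) (g : 'M[F]_n) (u v : 'cV[F]_n) :
  dotv u (g *m v) = dotv (g^T *m u) v.
Proof. by rewrite /dotv trmx_mul trmxK mulmxA. Qed.

Lemma dotv_col_mx (F : finFieldType) (m n : nat) (u u' : 'cV[F]_m)
    (v v' : 'cV[F]_n) :
  dotv (col_mx u v) (col_mx u' v') = dotv u u' + dotv v v'.
Proof. by rewrite /dotv tr_col_mx mul_row_col mxE. Qed.

Lemma dotv_delta (F : finFieldType) (n : nat) (i : 'I_n) (v : 'cV[F]_n) :
  dotv (delta_mx i 0) v = v i 0.
Proof. by rewrite /dotv trmx_delta -rowE mxE. Qed.

Lemma dotv_inj (F : finFieldType) (n : nat) (v v' : 'cV[F]_n) :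
  (forall u, dotv u v = dotv u v') -> v = v'.
Proof.
by move=> E; apply/colP => i; rewrite -!dotv_delta E.
Qed.

Lemma normq_dotv (F : finFieldType) (n : nat) (v : 'cV[F]_n) :
  Defs.normq v = dotv v v.
Proof. by rewrite dotvE. Qed.

(** * A Plancherel identity for hyperplane sections *)

Lemma card_cV (F : finFieldType) (n : nat) : #|{: 'cV[F]_n}| = (#|F| ^ n)%N.
Proof. by rewrite card_mx muln1. Qed.

(** The fibres of the nonzero linear form given by [v] are translates of one
    another along a coordinate vector on which the form does not vanish. *)
Lemma card_dotv_eq0 (F : finFieldType) (n : nat) (v : 'cV[F]_n) : v != 0 ->
  (#|F| * #|[set m : 'cV[F]_n | dotv m v == 0%R]| = #|F| ^ n)%N.
Proof.
move=> v0; have [i vi0] : exists i, v i 0 != 0.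
  apply/existsP; apply: contraNT v0 => /existsPn H.
  by apply/eqP/colP => i; rewrite mxE; apply/eqP; move: (H i); rewrite negbK.
rewrite -card_cV.
rewrite -[RHS]sum1_card (partition_big (fun m => dotv m v) predT) //=.
rewrite -sum_nat_const; apply: eq_bigr => t _; rewrite sum1dep_card.
set e : 'cV[F]_n := (t / v i 0) *: delta_mx i 0.
have et : dotv e v = t by rewrite dotvZl dotv_delta divfK.
rewrite -[LHS](card_imset _ (addIr e)); apply: eq_card => m; rewrite !inE.
apply/imsetP/eqP => [[m' + ->]|mt].
  by rewrite !inE dotvDl et => /eqP ->; rewrite add0r.
exists (m - e); last by rewrite subrK.
by rewrite inE dotvC dotvBr !(dotvC v) et mt subrr.
Qed.

(** A pair of points with [f p = f p'] collides in every direction [m], while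
    any other pair collides in a proportion [1 / #|F|] of the directions. *)
Lemma sum_collisions_dotv (F : finFieldType) (n : nat) (T : finType)
    (P : {set T}) (f : T -> 'cV[F]_n) :
  (#|F| * \sum_(m : 'cV[F]_n) collisions P (fun p => dotv m (f p)) =
   #|F| ^ n * (#|P| ^ 2 + #|F|.-1 * collisions P f))%N.
Proof.
have F0 : (0 < #|F|)%N by apply/card_gt0P; exists 0.
rewrite exchange_big big_distrr /= /collisions.
have -> : (#|P| ^ 2 = \sum_(p in P) \sum_(p' in P) 1)%N.
  by rewrite sum_nat_const sum1_card mulnn.
rewrite [in RHS]big_distrr -big_split big_distrr; apply: eq_bigr => p _ /=.
rewrite exchange_big big_distrr /= [in RHS]big_distrr -big_split big_distrr.
apply: eq_bigr => p' _ /=.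
have -> : (\sum_(m : 'cV[F]_n) (dotv m (f p) == dotv m (f p')) =
           #|[set m : 'cV[F]_n | dotv m (f p - f p') == 0%R]|)%N.
  rewrite -sum1dep_card [RHS]big_mkcond /=; apply: eq_bigr => m _.
  by rewrite dotvBr subr_eq0; case: eqP.
case: eqP => [->|/eqP ne].
  rewrite subrr muln1 add1n prednK // mulnC; congr (_ * _)%N.
  rewrite -card_cV; apply: eq_card => m.
  by rewrite !inE dotvC dot0v eqxx.
by rewrite muln0 addn0 muln1 card_dotv_eq0 ?subr_eq0.
Qed.

(** This is [#|F|] times the sum, over the values [t] in [F], of the squared
    deviation of the size of the fibre over [t] from its mean; it vanishes
    exactly when [f] is equidistributed. *)
Definition excess (R : realFieldType) (F : finFieldType) (T : finType)
    (P : {set T}) (f : T -> F) : R :=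
  #|F|%:R * (collisions P f)%:R - #|P|%:R ^+ 2.

Lemma excess_ge0 (R : realFieldType) (F : finFieldType) (T : finType)
    (P : {set T}) (f : T -> F) : 0 <= excess R P f.
Proof.
rewrite subr_ge0 -natrX -natrM ler_nat.
apply: leq_trans (card_sqr_leq_collisions P f) _.
by rewrite leq_mul2r max_card orbT.
Qed.

(** [sum_collisions_dotv] with the zero direction, in which all points collide,
    taken out. *)
Lemma sum_excess (R : realFieldType) (F : finFieldType) (n : nat)
    (T : finType) (P : {set T}) (f : T -> 'cV[F]_n) :
  \sum_(m : 'cV[F]_n | m != 0) excess R P (fun p => dotv m (f p)) =
  (#|F|%:R - 1) * (#|F|%:R ^+ n * (collisions P f)%:R - #|P|%:R ^+ 2).
Proof.
have F0 : (0 < #|F|)%N by apply/card_gt0P; exists 0.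
have E0 : excess R P (fun p => dotv 0 (f p)) = (#|F|%:R - 1) * #|P|%:R ^+ 2.
  suff C0 : collisions P (fun p => dotv 0 (f p)) = (#|P| ^ 2)%N.
    by rewrite /excess C0 natrX mulrBl mul1r.
  rewrite /collisions; under eq_bigr => p _ do
    under eq_bigr => p' _ do rewrite !dot0v eqxx.
  by rewrite !sum_nat_const muln1 mulnn.
have := sum_collisions_dotv P f => /(congr1 (fun k : nat => k%:R : R)).
rewrite !(natrM, natrD, natrX) -subn1 natrB // => PL.
have S : \sum_(m : 'cV[F]_n) excess R P (fun p => dotv m (f p)) =
  #|F|%:R ^+ n * (#|F|%:R - 1) * (collisions P f)%:R.
  rewrite sumrB -mulr_sumr -natr_sum PL sumr_const card_cV.
  rewrite -(mulr_natr (_ ^+ 2)) natrX.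
  by ring.
move: S; rewrite (bigD1 0) //= E0 => S.
by apply: (addrI ((#|F|%:R - 1) * #|P|%:R ^+ 2)); rewrite S; ring.
Qed.
(** * The orthogonal group *)

(** The translation by 1 permutes [F], so the sum of all elements is unchanged
    by adding [#|F|]; thus [#|F|] is zero in [F], and so would be the odd number
    1 if 2 were. *)
Lemma odd_card_two_neq0 (F : finFieldType) : odd #|F| -> 2 != 0 :> F.
Proof.
move=> oddF; have cardF0 : #|F|%:R = 0 :> F.
  have : \sum_(x : F) x = \sum_(x : F) (x + 1) := reindex_inj (addIr 1).
  rewrite big_split /= sumr_const => /eqP.
  by rewrite addrC -subr_eq subrr eq_sym => /eqP.
apply/eqP => two0; move: cardF0; rewrite -(odd_double_half #|F|) oddF natrD.
rewrite -muln2 natrM two0 mulr0 addr0 => /eqP.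
by rewrite oner_eq0.
Qed.

(** In odd characteristic the dot product is recovered from the quadratic form
    by polarization. *)
Lemma orthmxP (F : finFieldType) (n : nat) (g : 'M[F]_n) : odd #|F| ->
  reflect (g^T *m g = 1%:M) (g \in orthmx F n).
Proof.
move=> oddF; have two0 := odd_card_two_neq0 oddF.
rewrite inE; apply: (iffP forallP) => [gQ|gTg x]; last first.
  by rewrite !normq_dotv dotv_mulmx mulmxA gTg mul1mx.
have polar (x y : 'cV[F]_n) :
    2 * dotv x y = Defs.normq (x + y) - Defs.normq x - Defs.normq y.
  by rewrite !normq_dotv !dotvDl !dotvDr (dotvC y x); ring.
have dotg (x y : 'cV[F]_n) : dotv (g *m x) (g *m y) = dotv x y.
  apply: (mulfI two0); rewrite !polar -mulmxDr.
  by rewrite !(eqP (gQ _)).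
apply/matrixP => i j; suff /colP/(_ i) : col j (g^T *m g) = col j 1%:M.
  by rewrite !mxE.
apply: dotv_inj => u; rewrite !colE mul1mx -mulmxA.
by rewrite dotv_mulmx trmxK dotg.
Qed.

Lemma orthmx_tr (F : finFieldType) (n : nat) (g : 'M[F]_n) : odd #|F| ->
  g \in orthmx F n -> g^T \in orthmx F n.
Proof.
by move=> oddF /(orthmxP _ oddF)/mulmx1C gg; apply/orthmxP; rewrite // trmxK.
Qed.

Lemma orthmx_mul (F : finFieldType) (n : nat) (g h : 'M[F]_n) : 
  g \in orthmx F n -> h \in orthmx F n -> g *m h \in orthmx F n.
Proof.
rewrite !inE => /forallP gQ /forallP hQ; apply/forallP => x.
by rewrite -mulmxA (eqP (gQ _)).
Qed.

Lemma mulmx_orth_inj (F : finFieldType) (n : nat) (g : 'M[F]_n) m : odd #|F| ->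
  g \in orthmx F n -> injective (fun h : 'M[F]_(n, m) => g *m h).
Proof.
move=> oddF /(orthmxP _ oddF) gg; apply: (can_inj (g := mulmx g^T)) => h.
by rewrite mulmxA gg mul1mx.
Qed.

(** * Counting orthogonal matrices with a prescribed value *)

(** The reflection in the hyperplane orthogonal to [w]. *)
Definition reflmx (F : finFieldType) (n : nat) (w : 'cV[F]_n) : 'M[F]_n :=
  1%:M - (2 / dotv w w) *: (w *m w^T).

Lemma reflmxE (F : finFieldType) (n : nat) (w y : 'cV[F]_n) :
  reflmx w *m y = y - (2 / dotv w w * dotv w y) *: w.
Proof.
rewrite mulmxBl mul1mx -scalemxAl -mulmxA [w^T *m y]mx11_scalar.
by rewrite mul_mx_scalar scalerA.
Qed.

Lemma reflmx_orth (F : finFieldType) (n : nat) (w : 'cV[F]_n) :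
  dotv w w != 0 -> reflmx w \in orthmx F n.
Proof.
move=> ww0; rewrite inE; apply/forallP => y; apply/eqP.
rewrite reflmxE !normq_dotv; set a := _ * _.
have -> : dotv (y - a *: w) (y - a *: w) =
    dotv y y - 2 * a * dotv w y + a ^+ 2 * dotv w w.
  rewrite -scaleNr !dotvDl !dotvDr !dotvZl !dotvZr (dotvC y w); ring.
by rewrite /a; field.
Qed.

(** All coordinates but the first being given, the first one is determined up
    to sign. *)
Lemma card_sphere_leq (F : finFieldType) (n : nat) (t : F) :
  (#|[set x : 'cV[F]_(1 + n) | Defs.normq x == t]| <= 2 * #|F| ^ n)%N.
Proof.
rewrite -sum1_card (partition_big dsubmx predT) //=.
have -> : (2 * #|F| ^ n = \sum_(b : 'cV[F]_n) 2)%N.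
  by rewrite sum_nat_const card_cV mulnC.
apply: leq_sum => b _; rewrite sum1dep_card.
set S := finset _.
have [->|[x0]] := set_0Vmem S; first by rewrite cards0.
have fibreE x : x \in S -> exists2 u, x = col_mx u b & Defs.normq x = t.
  rewrite !inE => /andP[/eqP xt /eqP <-].
  by exists (usubmx x); rewrite // vsubmxK.
case/fibreE=> u0 -> u0t.
have /subset_leq_card/leq_trans :
    S \subset [set col_mx u0 b; col_mx (- u0) b].
  apply/subsetP => _ /fibreE[u -> /eqP]; rewrite -u0t !normq_dotv !dotv_col_mx.
  rewrite (inj_eq (addIr _)) !dotvE !big_ord1 -!expr2 eqf_sqr !inE.
  case/orP => /eqP E; apply/orP; [left|right]; apply/eqP; congr col_mx.
    by apply/colP => i; rewrite !ord1.
  by apply/colP => i; rewrite !ord1 mxE.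
by apply; rewrite cards2; case: (_ != _).
Qed.

(** Two matrices with the same first column differ by an element fixing the
    first basis vector, that is a block diagonal matrix with blocks 1 and an
    element of O(n). *)
Lemma card_orth_map1 (F : finFieldType) (n : nat) (v : 'cV[F]_(1 + n)) :
  odd #|F| ->
  (#|[set g in orthmx F (1 + n) | g *m col_mx 1%:M 0 == v]| <=
   #|orthmx F n|)%N.
Proof.
move=> oddF; set S := finset _.
have [->|[g0]] := set_0Vmem S; first by rewrite cards0.
rewrite inE => /andP[g0O /eqP g0v].
have fixes g : g \in S ->
  exists2 k, k \in orthmx F n & g0^T *m g = block_mx 1%:M 0 0 k.
  rewrite inE => /andP[gO /eqP gv].
  have hO := orthmx_mul (orthmx_tr oddF g0O) gO.
  set e := col_mx _ _ in g0v gv; set h := g0^T *m g in hO *.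
  have he : h *m e = e.
    by rewrite -mulmxA gv -g0v mulmxA (orthmxP _ oddF g0O) mul1mx.
  have hTe : h^T *m e = e.
    by rewrite -{1}he mulmxA (orthmxP _ oddF hO) mul1mx.
  have [a [b [c [k hE]]]] : exists a b c k, h = block_mx a b c k.
    exists (ulsubmx h), (ursubmx h), (dlsubmx h), (drsubmx h).
    by rewrite submxK.
  move: he hTe; rewrite hE tr_block_mx !mul_block_col.
  rewrite !mulmx1 !mulmx0 !addr0 => /eq_col_mx[-> ->] /eq_col_mx[_ /eqP].
  rewrite trmx_eq0 => /eqP b0; exists k; last by rewrite b0.
  rewrite inE; apply/forallP => x.
  move: hO; rewrite inE hE b0 => /forallP/(_ (col_mx 0 x)).
  rewrite mul_block_col !mul0mx !mulmx0 !add0r !normq_dotv !dotv_col_mx.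
  by rewrite !dot0v !add0r.
rewrite -(card_in_imset (f := fun g => drsubmx (g0^T *m g)) (D := S)).
  apply/subset_leq_card/subsetP => _ /imsetP[g gS ->].
  by have [k kO ->] := fixes g gS; rewrite block_mxKdr.
move=> g g' gS g'S; have [k _ E] := fixes g gS; have [k' _ E'] := fixes g' g'S.
rewrite E E' !block_mxKdr => kk'.
apply: (mulmx_orth_inj oddF (orthmx_tr oddF g0O)).
by rewrite E E' kk'.
Qed.

Lemma card_orth_leq (F : finFieldType) (n : nat) : odd #|F| ->
  (#|orthmx F (1 + n)| <= 2 * #|F| ^ n * #|orthmx F n|)%N.
Proof.
move=> oddF; set e : 'cV[F]_(1 + n) := col_mx 1%:M 0.
rewrite -sum1_card (partition_big (fun g => g *m e)
  (mem [set x : 'cV[F]_(1 + n) | Defs.normq x == Defs.normq e])) /=; last first.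
  by move=> g; rewrite !inE => /forallP/(_ e).
apply: (@leq_trans (\sum_(x in [set x : 'cV[F]_(1 + n) |
    Defs.normq x == Defs.normq e]) #|orthmx F n|)).
  by apply: leq_sum => v _; rewrite sum1dep_card card_orth_map1.
by rewrite sum_nat_const leq_mul2r card_sphere_leq orbT.
Qed.

(** These are the vectors whose reflection is defined and moves [y]. *)
Definition movers (F : finFieldType) (n : nat) (y : 'cV[F]_n) :
    {set 'cV[F]_n} :=
  [set w | (dotv w w != 0) && (dotv w y != 0)].

(** The complement is the union of a quadratic cone and a hyperplane. *)
Lemma card_movers (F : finFieldType) (n : nat) (y : 'cV[F]_(1 + n)) : y != 0 ->
  (#|F| ^ (1 + n) <= #|movers y| + 3 * #|F| ^ n)%N.
Proof.
move=> y0; rewrite -card_cV -cardsT (_ : setT = movers y :|: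
   ([set w | Defs.normq w == 0] :|: [set w | dotv w y == 0])); last first.
  apply/setP => w; rewrite !inE normq_dotv.
  by case: (dotv w w == 0); case: (dotv w y == 0).
apply: leq_trans (leq_card_setU _ _).1 _; rewrite leq_add2l.
apply: leq_trans (leq_card_setU _ _).1 _.
have F0 : (0 < #|F|)%N by apply/card_gt0P; exists 0.
have := card_dotv_eq0 y0; rewrite expnS => /eqP.
rewrite eqn_pmul2l // => /eqP ->.
by rewrite [leqRHS]mulSn addnC leq_add2l card_sphere_leq.
Qed.

(** The displacement of [y] under the reflection is a nonzero multiple of [w],
    so [w] lies on the line of [y - z]. *)
Lemma card_refl_map (F : finFieldType) (n : nat) (y z : 'cV[F]_n) :
  odd #|F| ->
  (#|[set w in movers y | reflmx w *m y == z]| <= #|F|)%N.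
Proof.
move=> oddF; have two0 := odd_card_two_neq0 oddF.
apply: leq_trans (leq_imset_card (fun t : F => t *: (y - z)) predT).
apply/subset_leq_card/subsetP => w.
rewrite !inE => /andP[/andP[ww0 wy0] /eqP <-].
apply/imsetP; exists ((2 / dotv w w * dotv w y)^-1) => //.
rewrite reflmxE opprB addrC subrK scalerA.
by rewrite mulVf ?scale1r // !mulf_neq0 ?invr_eq0.
Qed.

(** Composing with the reflection along [w] embeds the set of [g] with
    [g *m x = y] into the set of [g] with [g *m x = reflmx w *m y].  Summing over
    [w], each [g] is counted at most [#|F|] times, by [card_refl_map]. *)
Lemma card_orth_map_movers (F : finFieldType) (n : nat) (x y : 'cV[F]_n) :
  odd #|F| ->
  (#|[set g in orthmx F n | g *m x == y]| * #|movers y| <=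
   #|F| * #|orthmx F n|)%N.
Proof.
move=> oddF; rewrite mulnC -sum_nat_const.
apply: (@leq_trans (\sum_(w in movers y)
    #|[set g in orthmx F n | g *m x == reflmx w *m y]|)).
  apply: leq_sum => w; rewrite inE => /andP[ww0 _].
  have wO := reflmx_orth ww0.
  rewrite -(card_imset _ (mulmx_orth_inj (m := n) oddF wO)).
  apply/subset_leq_card/subsetP => _ /imsetP[g gS ->].
  move: gS; rewrite [g \in _]inE => /andP[gO /eqP gx].
  by rewrite inE -mulmxA gx eqxx andbT orthmx_mul.
under eq_bigr => w _ do rewrite -sum1dep_card big_mkcondr.
rewrite exchange_big /= mulnC -sum_nat_const; apply: leq_sum => g _.
rewrite -big_mkcondr sum1dep_card.
apply: leq_trans (card_refl_map y (g *m x) oddF).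
by apply/subset_leq_card/subsetP => w; rewrite !inE (eq_sym (g *m x)).
Qed.

(** [card_movers] is of the expected order of magnitude only when [#|F| >= 5];
    for smaller fields the number of all matrices is bounded in terms of the
    dimension, and this is where the constant comes from. *)
Lemma card_orth_map_leq (F : finFieldType) (n : nat) (x y : 'cV[F]_(1 + n)) :
  odd #|F| -> x != 0 ->
  (#|[set g in orthmx F (1 + n) | g *m x == y]| <=
   5 ^ ((1 + n) * (1 + n)) * #|orthmx F n|)%N.
Proof.
move=> oddF x0; have F0 : (0 < #|F|)%N by apply/card_gt0P; exists 0.
have O0 : (0 < #|orthmx F n|)%N.
  by apply/card_gt0P; exists 1%:M; apply/orthmxP; rewrite // trmx1 mul1mx.
set S := #|_|; case: (ltnP #|F| 5) => [F5|F5].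
  apply: (@leq_trans (5 ^ ((1 + n) * (1 + n)))); last by rewrite leq_pmulr.
  apply: leq_trans (max_card _) _.
  by rewrite card_mx leq_exp2r // ltnW.
have [S0|S0] := posnP S; first by rewrite S0.
have y0 : y != 0.
  move: S0 => /card_gt0P[g]; rewrite inE => /andP[/(orthmxP _ oddF) gg /eqP <-].
  apply: contraNneq x0 => gx0.
  by rewrite -[x]mul1mx -gg -mulmxA gx0 mulmx0.
apply: (@leq_trans (5 * #|orthmx F n|)); last first.
  by rewrite leq_mul2r -{1}(expn1 5) leq_exp2l // orbT.
have H1 := card_orth_map_movers x y oddF; rewrite -/S in H1.
have H2 := card_movers y0; have H3 := card_orth_leq n oddF.
rewrite expnS in H2; have Q0 : (0 < #|F| ^ n)%N by rewrite expn_gt0 F0.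
rewrite -(leq_pmul2l (m := 2 * (#|F| * #|F| ^ n))) ?muln_gt0 ?F0 //.
set Q := (#|F| ^ n)%N in H2 H3 Q0 *; set O := #|orthmx F n| in H3 *.
(* 5 q^n (q - 3) >= 2 q^(n+1) is where q >= 5 enters. *)
have H4 : (2 * (#|F| * Q) <= 5 * #|movers y|)%N by nia.
apply: (@leq_trans (5 * #|movers y| * S)); first by rewrite leq_mul2r H4 orbT.
apply: (@leq_trans (5 * (#|F| * (2 * Q * O)))); last by lia.
rewrite -mulnA leq_mul2l /= mulnC; apply: leq_trans H1 _.
by rewrite leq_mul2l H3 orbT.
Qed.
(** * The second moment over all rotations *)

Definition rotsub (F : finFieldType) (n : nat) (g : 'M[F]_n)
    (p : 'cV[F]_n * 'cV[F]_n) : 'cV[F]_n := p.1 - g *m p.2.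

Lemma imset_rotsub (F : finFieldType) (n : nat) (A B : {set 'cV[F]_n})
    (g : 'M[F]_n) :
  [set rotsub g p | p in setX A B] = rotdiff A g B.
Proof.
apply/setP => x; apply/imsetP/imset2P => [[[a b]]|[a b Aa Bb ->]].
  by rewrite inE => /andP[/= Aa Bb] ->; exists a b.
by exists (a, b); rewrite ?inE ?Aa.
Qed.

(** The left-hand side is [#|F|^n] times the sum over [g] of the deviation of the
    number of collisions from [#|P|^2 / #|F|^n].  The bound loses only the
    maximal multiplicity [S] with which the graphs of the maps [- g^T] cover a
    nonzero vector of the doubled space. *)
Lemma sum_collisions_rotsub (R : realFieldType) (F : finFieldType) (n S : nat)
    (P : {set 'cV[F]_n * 'cV[F]_n}) : odd #|F| ->
  (forall x y : 'cV[F]_n, x != 0 ->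
     (#|[set g in orthmx F n | g *m x == y]| <= S)%N) ->
  \sum_(g in orthmx F n)
    (#|F|%:R ^+ n * (collisions P (rotsub g))%:R - #|P|%:R ^+ 2) <=
  S%:R * #|F|%:R ^+ (n + n) * #|P|%:R :> R.
Proof.
move=> oddF hS; set q : R := #|F|%:R.
have F1 : (1 < #|F|)%N := card_finNzRing_gt1 F.
have q1 : 0 < q - 1 by rewrite subr_gt0 ltr1n.
rewrite -(ler_pM2l q1) mulr_sumr.
pose f (p : 'cV[F]_n * 'cV[F]_n) := col_mx p.1 p.2.
pose Phi (w : 'cV[F]_(n + n)) : R := excess R P (fun p => dotv w (f p)).
pose psi (gm : 'M[F]_n * 'cV[F]_n) := col_mx gm.2 (- (gm.1^T *m gm.2)).
have Phi0 w : 0 <= Phi w by apply: excess_ge0.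
(* m . (a - g b) = m . a + (- g^T m) . b *)
have slice g : (q - 1) * (q ^+ n * (collisions P (rotsub g))%:R - #|P|%:R ^+ 2)
    = \sum_(m : 'cV[F]_n | m != 0) Phi (psi (g, m)).
  rewrite -sum_excess; apply: eq_bigr => m _; rewrite /Phi /excess.
  congr (_ * _%:R - _); rewrite /collisions.
  have E p : dotv m (rotsub g p) = dotv (psi (g, m)) (f p).
    rewrite /rotsub /psi /f dotv_col_mx dotvBr dotv_mulmx -scaleN1r dotvZl.
    by rewrite mulN1r.
  by apply: eq_bigr => p _; apply: eq_bigr => p' _; rewrite !E.
under eq_bigr => g _ do rewrite slice.
rewrite pair_big /=.
rewrite (partition_big psi (fun w => w != 0)) /=; last first.
  move=> [g m] /= /andP[_ m0]; apply: contraNneq m0.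
  by move=> /(congr1 usubmx)/eqP; rewrite col_mxKu linear0.
have -> : (q - 1) * (S%:R * q ^+ (n + n) * #|P|%:R) =
    S%:R * ((q - 1) * (q ^+ (n + n) * #|P|%:R)) by ring.
apply: (@le_trans _ _ (S%:R * \sum_(w : 'cV[F]_(n + n) | w != 0) Phi w)).
  rewrite mulr_sumr; apply: ler_sum => w w0.
  (* For w = (u, v) the pairs are (g, u) with g v = - u. *)
  pose fibre := [set p : 'M[F]_n * 'cV[F]_n |
    (p.1 \in orthmx F n) && (p.2 != 0) && (psi p == w)].
  rewrite (eq_bigl (fun p => p \in fibre)); last first.
    by case=> g m; rewrite [RHS]inE.
  rewrite (eq_bigr (fun=> Phi w)); last first.
    by case=> g m; rewrite inE => /andP[_ /eqP <-].
  rewrite sumr_const -[leLHS]mulr_natl ler_wpM2r // ler_nat.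
  have fibreP p : p \in fibre -> [/\ p.1 \in orthmx F n, usubmx w = p.2 &
      p.1 *m dsubmx w = - usubmx w] /\ p.2 != 0.
    rewrite inE => /andP[/andP[pO p0] /eqP <-]; split=> //; split=> //.
      by rewrite col_mxKu.
    have /(orthmxP _ oddF)/mulmx1C gg := pO.
    by rewrite col_mxKu col_mxKd mulmxN mulmxA gg mul1mx.
  have [-> |[p pf]] := set_0Vmem fibre; first by rewrite cards0.
  have v0 : dsubmx w != 0.
    have [[_ up gp]] := fibreP p pf; rewrite -up; apply: contraNneq => v0.
    by apply/eqP/oppr_inj; rewrite -gp v0 mulmx0 oppr0.
  apply: leq_trans (hS (dsubmx w) (- usubmx w) v0).
  rewrite -(card_in_imset (f := fst) (D := fibre)); last first.
    move=> [g m] [g' m'] /fibreP[[_ /= um _] _] /fibreP[[_ /= um' _] _] /= ->.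
    by rewrite -um -um'.
  apply/subset_leq_card/subsetP => _ /imsetP[p' /fibreP[[gO _ gE] _] ->].
  by rewrite inE gO gE eqxx.
rewrite ler_wpM2l // sum_excess ler_wpM2l ?(ltW q1) //.
rewrite collisions_inj.
  by rewrite gerBl exprn_ge0.
by move=> [a b] [a' b'] _ _ /eq_col_mx[/= -> ->].
Qed.

(** * Exceptional rotations *)

Theorem theorem7p1 (R : realType) (d : nat) (hd : (2 <= d)%N) :
  exists C c : R, [/\ 0 < C, 0 < c &
    forall (F : finFieldType) (hq : odd #|F|) (eps : R) (heps : 0 < eps)
           (A B : {set 'cV[F]_d}) (hAB : (#|A| <= #|B|)%N)
           (hB : #|B|%:R `^ (1 + eps) < #|F|%:R ^+ d / 2),
    exists E : {set 'M[F]_d},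
      [/\ E \subset orthmx F d,
          #|E|%:R * #|A|%:R <=
            C * (#|orthmx F (d - 1)|%:R * #|F|%:R ^+ d * #|B|%:R `^ eps) &
          forall g : 'M[F]_d, g \in orthmx F d :\: E ->
            c * #|B|%:R `^ (1 + eps) <= #|rotdiff A g B|%:R]].
Proof.
exists (2 * (5 ^ (d * d))%:R), 1.
split; [by rewrite mulr_gt0 // ltr0n expn_gt0 | by [] |].
move=> F oddF eps eps0 A B hAB; set X : R := _ `^ (1 + eps) => hX.
pose E := [set g in orthmx F d | #|rotdiff A g B|%:R < X].
exists E; split; first by apply/subsetP => g; rewrite inE => /andP[].
  2: by move=> g; rewrite !inE => /andP[+ gO]; rewrite gO /= -leNgt mul1r.
set P := setX A B; set q : R := #|F|%:R.
have cardP : #|P|%:R = #|A|%:R * #|B|%:R :> R by rewrite cardsX natrM.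
have rhs0 : 0 <= 2 * (5 ^ (d * d))%:R *
   (#|orthmx F (d - 1)|%:R * q ^+ d * #|B|%:R `^ eps).
  by rewrite !mulr_ge0 ?ler0n ?exprn_ge0 ?powR_ge0.
(* The estimate is vacuous when A is empty; otherwise one may divide by |P|. *)
have [A0|A0] := posnP #|A|; first by rewrite A0 mulr0.
have B0 : (0 < #|B|)%N := leq_trans A0 hAB.
have P0 : 0 < #|P|%:R :> R by rewrite cardP mulr_gt0 ?ltr0n.
have q0 : 0 < q by rewrite ltr0n (ltn_trans _ (card_finNzRing_gt1 F)).
have X0 : 0 <= X by apply: powR_ge0.
pose S := (5 ^ (d * d) * #|orthmx F (d - 1)|)%N.
have hS (x y : 'cV[F]_d) : x != 0 ->
    (#|[set g in orthmx F d | g *m x == y]| <= S)%N.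
  rewrite /S; case: (d) hd x y => // n _ x y x0.
  by rewrite subn1; apply: (card_orth_map_leq (n := n)).
have cauchy g : #|P|%:R ^+ 2 <=
    #|rotdiff A g B|%:R * (collisions P (rotsub g))%:R :> R.
  rewrite -natrX -natrM ler_nat -imset_rotsub.
  exact: card_sqr_leq_collisions.
have var_ge0 g : 0 <= q ^+ d * (collisions P (rotsub g))%:R - #|P|%:R ^+ 2.
  rewrite subr_ge0; apply: le_trans (cauchy g) _; rewrite ler_wpM2r //.
  by rewrite -natrX ler_nat -card_cV max_card.
have var_large g : g \in E -> q ^+ d * #|P|%:R ^+ 2 <=
    2 * X * (q ^+ d * (collisions P (rotsub g))%:R - #|P|%:R ^+ 2).
  rewrite inE => /andP[_ gX].
  have PX : #|P|%:R ^+ 2 <= X * (collisions P (rotsub g))%:R.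
    by apply: le_trans (cauchy g) _; rewrite ler_wpM2r // ltW.
  have qd0 : 0 <= q ^+ d by rewrite exprn_ge0 ?ltW.
  have := ler_wpM2l qd0 PX.
  have P2 : 0 <= #|P|%:R ^+ 2 :> R by rewrite exprn_ge0.
  (* The hypothesis on |B|: half of the main term survives the subtraction. *)
  have Xq : 0 <= q ^+ d - 2 * X by lra.
  have := mulr_ge0 Xq P2.
  lra.
have total := sum_collisions_rotsub R P oddF hS.
have main : #|E|%:R * (q ^+ d * #|P|%:R ^+ 2) <=
    2 * X * (S%:R * q ^+ (d + d) * #|P|%:R).
  apply: le_trans (ler_wpM2l (mulr_ge0 (ler0n _ 2) X0) total).
  rewrite mulr_natl -sumr_const mulr_sumr.
  rewrite [leRHS](big_setID E) /=.
  rewrite (setIidPr _); last by apply/subsetP => g; rewrite inE => /andP[].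
  apply: le_trans (ler_sum _ var_large) _.
  by rewrite lerDl sumr_ge0 // => g _; rewrite !mulr_ge0.
have XE : X = #|B|%:R * #|B|%:R `^ eps.
  by rewrite /X powRD ?powRr1 // pnatr_eq0 -lt0n B0 implybT.
have K0 : 0 < q ^+ d * #|P|%:R * #|B|%:R 
  by rewrite mulr_gt0 ?ltr0n // mulr_gt0 ?exprn_gt0.
rewrite -(ler_pM2r K0).
rewrite [leLHS](_ : _ = #|E|%:R * (q ^+ d * #|P|%:R ^+ 2)); last first.
  by rewrite cardP; ring.
rewrite [leRHS](_ : _ = 2 * X * (S%:R * q ^+ (d + d) * #|P|%:R)) //.
by rewrite XE /S natrM exprD; ring.
Qed.
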